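(* Let $n\ge 1$. An interval $[S,T]$ of the Tamari lattice $\mathrm{Tam}_n$ is new if and only if the corresponding interval-poset is new.
   Context: **Binary trees and the Tamari lattice.** A (planar) binary tree of size $n$ is a rooted planar tree with $n$ inner vertices, each having a left child and a right child (each child is an inner vertex or a leaf); it has $n+1$ leaves, labelled $1,\dots,n+1$ from left to right. ''Vertex'' means inner vertex. Write $X\wedge Z$ for the tree whose root has left subtree $X$ and right subtree $Z$. $\mathrm{Tam}_n$ is the set of binary trees of size $n$, ordered by the reflexive transitive closure of the covering relation in which a tree is covered by any tree obtained from it by replacing one subtree of the form $(A\wedge B)\wedge C$ by $A\wedge(B\wedge C)$. The vertices of a tree $S$ of size $n$ are labelled $1,\dots,n$ in in-order (recursively: left subtree, root, right subtree), and $i\lhd_S j$ means that vertex $i$ lies in the subtree rooted at vertex $j$ (including $i=j$). **Interval-posets.** An interval-poset of size $n$ is a (reflexive) partial order $\lhd$ on $\{1,\dots,n\}$ such that for all $a<b<c$: $a\lhd c$ implies $b\lhd c$, and $c\lhd a$ implies $b\lhd a$. For $a<b$, a relation $a\lhd b$ is called increasing (starting at $a$) and a relation $b\lhd a$ decreasing (starting at $b$). The interval-poset corresponding to an interval $[S,T]$ of $\mathrm{Tam}_n$ is the reflexive relation whose decreasing relations are those of $\lhd_S$ and whose increasing relations are those of $\lhd_T$; this is a (known) bijection between intervals of $\mathrm{Tam}_n$ and interval-posets of size $n$. **New intervals.** For $T\in\mathrm{Tam}_p$, $S\in\mathrm{Tam}_q$ and $1\le i\le p+1$, $T\circ_i S\in\mathrm{Tam}_{p+q}$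 is the tree obtained by grafting the root of $S$ on the $i$-th leaf of $T$. The $i$-th grafting of the interval $[S_2,T_2]$ on $[S_1,T_1]$ is the interval $[S_1\circ_i S_2,\,T_1\circ_i T_2]$. An interval is new if it cannot be obtained as the grafting of two intervals (of trees of sizes $p,q\ge 1$). **New interval-posets.** An interval-poset $P$ of size $n$ is new if it has no increasing relation starting at $1$, no decreasing relation starting at $n$, and there are no $i<j$ with both $i+1\lhd j+1$ and $j\lhd i$. *)

(* Defs.v *)
From Stdlib Require Import Relation_Operators.
From mathcomp Require Import all_boot.

Set Implicit Arguments.
Unset Strict Implicit.
Unset Printing Implicit Defensive.

Inductive btree : Type :=
| Leaf
| Node of btree & btree.

Fixpoint bsize (t : btree) : nat :=
  if t is Node l r then (bsize l + bsize r).+1 else 0.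

(* [tam_cover s t]: t is obtained from s by one right rotation. *)
Inductive tam_cover : btree -> btree -> Prop :=
| TamRot a b c :
    tam_cover (Node (Node a b) c) (Node a (Node b c))
| TamLeft l l' r : tam_cover l l' -> tam_cover (Node l r) (Node l' r)
| TamRight l r r' : tam_cover r r' -> tam_cover (Node l r) (Node l r').

Definition tam_le : btree -> btree -> Prop := clos_refl_trans btree tam_cover.

(* The Tamari interval [S, T] is represented by its pair of end points. *)
Definition tam_interval (n : nat) (S T : btree) : Prop :=
  [/\ bsize S = n, bsize T = n & tam_le S T].

(* An inner vertex is represented by its address, the path leading to it from
   the root (false = left child, true = right child). Thus v lies in the
   subtree rooted at w iff the address of w is a prefix of that of v. *)
Fixpoint inorder (t : btree) : seq (seq bool) :=
  if t is Node l r then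
    map (cons false) (inorder l) ++ [::] :: map (cons true) (inorder r)
  else [::].

(* Labels run from 1 to [bsize t]. *)
Definition vertex (t : btree) (i : nat) : seq bool := nth [::] (inorder t) i.-1.

Definition lhd (t : btree) (i j : nat) : bool :=
  [&& 1 <= i <= bsize t, 1 <= j <= bsize t & prefix (vertex t j) (vertex t i)].

(* [graft t i s] is t o_i s; leaves are numbered from 1, and the value is only
   meaningful for 1 <= i <= bsize t + 1. The left subtree l of a node contains
   the leaves 1, ..., bsize l + 1. *)
Fixpoint graft (t : btree) (i : nat) (s : btree) : btree :=
  if t is Node l r then
    if i <= (bsize l).+1 then Node (graft l i s) r
    else Node l (graft r (i - (bsize l).+1) s)
  else s.

Definition new_interval (S T : btree) : Prop :=
  ~ exists (p q i : nat) (S1 T1 S2 T2 : btree),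
      [/\ 1 <= p /\ 1 <= q,
          tam_interval p S1 T1,
          tam_interval q S2 T2,
          1 <= i <= p.+1 &
          S = graft S1 i S2 /\ T = graft T1 i T2].

(* A relation on {1, ..., n} is a relation on nat supported on that set. *)
Record interval_poset (n : nat) (P : rel nat) : Prop := IntervalPoset {
  ip_supp : forall a b, P a b -> (1 <= a <= n) /\ (1 <= b <= n);
  ip_refl : forall a, 1 <= a <= n -> P a a;
  ip_anti : forall a b, P a b -> P b a -> a = b;
  ip_trans : forall a b c, P a b -> P b c -> P a c;
  ip_incr : forall a b c, a < b -> b < c -> P a c -> P b c;
  ip_decr : forall a b c, a < b -> b < c -> P c a -> P b a
}.

Definition poset_of_interval (n : nat) (S T : btree) : rel nat :=
  fun a b =>
    [|| (a == b) && (1 <= a <= n),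
        (b < a) && lhd S a b
      | (a < b) && lhd T a b].

Definition new_interval_poset (n : nat) (P : rel nat) : Prop :=
  [/\ interval_poset n P,
      ~ (exists b, 1 < b /\ P 1 b),
      ~ (exists a, a < n /\ P n a) &
      ~ (exists i j, [/\ i < j, P i.+1 j.+1 & P j i])].

(* Main.v *)
Require Import Defs.
From Stdlib Require Import Relation_Operators.
From mathcomp Require Import all_boot.
From mathcomp Require Import zify.

(** The inner vertices of the subtree of [t] rooted at vertex [j] are labelled
    by an integer interval [j - ldesc t j, j + rdesc t j] around [j], and a
    tree is determined by these intervals. Right rotations can only raise the
    left and right ends, and conversely the pointwise order on right ends is the
    Tamari order ([tam_le_of_rdesc]). The poset [P] of the interval from [S] to
    [T] is then described by the left ends of [T] and the right ends of [S]: for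
    labels [a] and [b], [P a b] iff [b - ldesc T b <= a <= b + rdesc S b].

    A tree is a grafting with inserted tree on the labels [i, i + q - 1]
    exactly when no vertex of this block has a descendant outside the block
    ([graft_of_block]). When [S <= T], this holds for both [S] and [T] as soon
    as it holds for the left ends of [S] and the right ends of [T], the
    extremal choices. Each of the three forbidden patterns of a new
    interval-poset says that a block is enclosed on its left by a vertex of [S]
    and on its right by a vertex of [T] (a side on which the block reaches the
    end of [1, n] needing no such vertex), which confines the block in this
    sense. The two inserted trees, and the two trees they are inserted in,
    are comparable because the right ends of [S] and [T] are strictly increasing
    functions of theirs ([rdesc_graft]). Conversely, the leaf where a
    grafting takes place lies below both vertices surrounding it, so
    the inserted block is enclosed in both [S] and [T] and yields one of the
    three patterns. *)

(** * Descendant intervals of the vertices of a tree *)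

(** The sequence of the [rdesc t k] is the bracket vector of [t]; outside of
    [1, bsize t], the recursion ends at a leaf and gives [0]. *)
Fixpoint rdesc (t : btree) (k : nat) : nat :=
  if t is Node l r then
    if k <= bsize l then rdesc l k
    else if k == (bsize l).+1 then bsize r
    else rdesc r (k - (bsize l).+1)
  else 0.

Fixpoint ldesc (t : btree) (k : nat) : nat :=
  if t is Node l r then
    if k <= bsize l then ldesc l k
    else if k == (bsize l).+1 then bsize l
    else ldesc r (k - (bsize l).+1)
  else 0.

Lemma rdesc_bound t k : k <= bsize t -> k + rdesc t k <= bsize t.
Proof.
elim: t k => [|l IHl r IHr] k /= Hk; first by lia.
case: (leqP k (bsize l)) => Hl; first by have := IHl k Hl; lia.
case: eqP => He; first by lia.
by have := IHr (k - (bsize l).+1); lia.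
Qed.

Lemma rdesc_default t k : bsize t < k -> rdesc t k = 0.
Proof.
elim: t k => //= l _ r IHr k Hk.
have -> : (k <= bsize l) = false by lia.
have -> : (k == (bsize l).+1) = false by lia.
by apply: IHr; lia.
Qed.

Lemma ldesc_bound t k : 1 <= k -> ldesc t k < k.
Proof.
elim: t k => [|l IHl r IHr] k /= Hk; first by lia.
case: (leqP k (bsize l)) => Hl; first exact: IHl.
case: eqP => He; first by lia.
by have := IHr (k - (bsize l).+1); lia.
Qed.

(** This is the transitivity of the descendant relation, in the form of an
    inclusion between intervals of labels. *)
Lemma desc_nested t j k :
  1 <= j <= bsize t -> 1 <= k ->
  j <= k + ldesc t j -> k <= j + rdesc t j ->
  (j + ldesc t k <= k + ldesc t j) /\ (k + rdesc t k <= j + rdesc t j).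
Proof.
elim: t j k => [|l IHl r IHr] j k /=; first by lia.
move=> Hj Hk.
case: (leqP j (bsize l)) => Hjl.
  have Hb := rdesc_bound l j Hjl.
  move=> H1 H2; have -> : k <= bsize l by lia.
  by apply: IHl; lia.
case: eqP => Hjr.
  move=> H1 H2.
  case: (leqP k (bsize l)) => Hkl.
    have := rdesc_bound l k Hkl; have := ldesc_bound l k Hk; lia.
  case: eqP => Hkr; first by lia.
  have := rdesc_bound r (k - (bsize l).+1).
  have := ldesc_bound r (k - (bsize l).+1).
  by lia.
move=> H1 H2.
have Hb := ldesc_bound r (j - (bsize l).+1).
have -> : (k <= bsize l) = false by lia.
have -> : (k == (bsize l).+1) = false by lia.
have := IHr (j - (bsize l).+1) (k - (bsize l).+1).
by lia.
Qed.

Lemma desc_antisym t a b :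
  1 <= a -> a < b -> b <= a + ldesc t b -> b <= a + rdesc t a -> False.
Proof.
elim: t a b => [|l IHl r IHr] a b /=; first by lia.
move=> Ha Hab.
case: (leqP b (bsize l)) => Hbl.
  have -> : a <= bsize l by lia.
  exact: IHl.
case: (leqP a (bsize l)) => Hal.
  by have := rdesc_bound l a Hal; lia.
case: eqP => Hbr; first by lia.
case: eqP => Har.
  by have := ldesc_bound r (b - (bsize l).+1); lia.
move=> H1 H2; apply: (IHr (a - (bsize l).+1) (b - (bsize l).+1)); lia.
Qed.

Lemma size_inorder t : size (inorder t) = bsize t.
Proof.
by elim: t => //= l IHl r IHr; rewrite size_cat /= !size_map IHl IHr addnS.
Qed.

Lemma vertex_Node l r i : 1 <= i <= (bsize l + bsize r).+1 ->
  vertex (Node l r) i =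
    if i <= bsize l then false :: vertex l i
    else if i == (bsize l).+1 then [::]
    else true :: vertex r (i - (bsize l).+1).
Proof.
move=> Hi; rewrite /vertex /= nth_cat size_map size_inorder.
case: (leqP i (bsize l)) => Hl.
  have Hl' : i.-1 < bsize l by lia.
  by rewrite Hl' (nth_map [::]) ?size_inorder.
have -> : (i.-1 < bsize l) = false by lia.
case: eqP => He; first by have -> : i.-1 - bsize l = 0 by lia.
have -> : i.-1 - bsize l = (i - (bsize l).+1).-1.+1 by lia.
by rewrite /= (nth_map [::]) // size_inorder; lia.
Qed.

Lemma lhdE t i j :
  lhd t i j = [&& 1 <= i <= bsize t, 1 <= j <= bsize t,
                  j <= i + ldesc t j & i <= j + rdesc t j].
Proof.
rewrite /lhd; case Hi: (1 <= i <= _) => //; case Hj: (1 <= j <= _) => //=.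
elim: t i j Hi Hj => [|l IHl r IHr] i j Hi Hj /=; first by move: Hi => /=; lia.
rewrite !vertex_Node //; move: Hi Hj => /= Hi Hj.
have Hlb := rdesc_bound l j.
have Hrb := ldesc_bound r (j - (bsize l).+1).
case: (leqP j (bsize l)) => Hjl.
  case: (leqP i (bsize l)) => Hil /=; first by apply: IHl; lia.
  by case: eqP => _ /=; lia.
case: (j =P (bsize l).+1) => Hjr; first by rewrite prefix0s; lia.
case: (leqP i (bsize l)) => Hil /=; first by lia.
case: eqP => Hir /=; first by lia.
rewrite IHr; lia.
Qed.

(** * Right ends characterize the Tamari order *)

Lemma bsize_tam_le s t : tam_le s t -> bsize s = bsize t.
Proof.
elim=> {s t} [s t|//|s u t _ -> _ ->//].
by elim=> [a b c|l l' r _ IH|l r r' _ IH] /=; lia.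
Qed.

(** A rotation at [(A /\ B) /\ C] changes only two intervals: the right one of
    the vertex between [A] and [B], which gains [C], and the left one of the
    vertex between [B] and [C], which loses [A]. *)
Lemma tam_cover_desc s t k :
  tam_cover s t -> rdesc s k <= rdesc t k /\ ldesc t k <= ldesc s k.
Proof.
move=> H; elim: H k => {s t} [a b c|l l' r H IH|l r r' H IH] k /=.
- case: (leqP k (bsize a)) => Ha.
    by have -> : k <= (bsize a + bsize b).+1 by lia.
  case: (k =P (bsize a).+1) => Hx.
    have -> : k <= (bsize a + bsize b).+1 by lia.
    by lia.
  case: (leqP k (bsize a + bsize b).+1) => Hb.
    by have -> : k - (bsize a).+1 <= bsize b by lia.
  have -> : (k - (bsize a).+1 <= bsize b) = false by lia.
  case: (k =P (bsize a + bsize b).+2) => Hy.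
    have -> : (k - (bsize a).+1 == (bsize b).+1) = true by lia.
    by lia.
  have -> : (k - (bsize a).+1 == (bsize b).+1) = false by lia.
  have -> // : k - (bsize a).+1 - (bsize b).+1 = k - (bsize a + bsize b).+2.
  by lia.
- have <- : bsize l = bsize l' by apply: bsize_tam_le; apply: rt_step.
  by case: (leqP k (bsize l)) => _ //; split; apply: leqnn.
- have <- : bsize r = bsize r' by apply: bsize_tam_le; apply: rt_step.
  case: (leqP k (bsize l)) => _; first by split; apply: leqnn.
  case: eqP => _; last exact: IH.
  by split; lia.
Qed.

Lemma tam_le_desc s t k :
  tam_le s t -> rdesc s k <= rdesc t k /\ ldesc t k <= ldesc s k.
Proof.
elim=> {s t} [s t|//|s u t _ [H1 H2] _ [H3 H4]]; first exact: tam_cover_desc.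
by split; [apply: leq_trans H3 | apply: leq_trans H2].
Qed.

Lemma tam_le_Node l l' r r' :
  tam_le l l' -> tam_le r r' -> tam_le (Node l r) (Node l' r').
Proof.
move=> Hl Hr; apply: (rt_trans _ _ _ (Node l' r)).
  elim: Hl => {l l'} [l l' H|l|l u l' _ H1 _ H2].
  - exact/rt_step/TamLeft.
  - exact: rt_refl.
  - exact: rt_trans H1 H2.
elim: Hr => {r r'} [r r' H|r|r u r' _ H1 _ H2].
- exact/rt_step/TamRight.
- exact: rt_refl.
- exact: rt_trans H1 H2.
Qed.

(** When no vertex before [y] has [y] among its descendants, [y] is reached
    from the root by left steps only, and right rotations along this branch
    bring it to the root without changing any other right end. *)
Lemma tam_rotate_to_root u y :
  1 <= y <= bsize u ->
  (forall k, 1 <= k < y -> k + rdesc u k < y) ->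
  exists a b, [/\ tam_le u (Node a b), bsize a = y.-1,
    forall k, k < y -> rdesc a k = rdesc u k &
    forall k, 1 <= k -> rdesc b k = rdesc u (y + k)].
Proof.
elim: u y => [|l IHl r _] y /=; first by lia.
move=> Hy Hu.
case: (ltngtP y (bsize l).+1) => Hyl.
- have [||a [b [Hle Ha Hra Hrb]]] := IHl y; first by lia.
    move=> k Hk; have := Hu k Hk.
    by have -> : k <= bsize l by lia.
  have /= Hs := bsize_tam_le _ _ Hle.
  exists a, (Node b r); split => //.
  + apply: (rt_trans _ _ _ (Node (Node a b) r)).
      by apply: tam_le_Node => //; apply: rt_refl.
    by apply: rt_step; apply: TamRot.
  + move=> k Hk; rewrite Hra //.
    by have -> : k <= bsize l by lia.
  + move=> k Hk /=; rewrite Hrb //.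
    have -> : (y + k <= bsize l) = (k <= bsize b) by lia.
    have -> : (y + k == (bsize l).+1) = (k == (bsize b).+1) by lia.
    by have -> : y + k - (bsize l).+1 = k - (bsize b).+1 by lia.
- by have := Hu (bsize l).+1; rewrite ltnn eqxx; lia.
- exists l, r; split; first exact: rt_refl.
  + by lia.
  + by move=> k Hk; have -> : k <= bsize l by lia.
  + move=> k Hk.
    have -> : (y + k <= bsize l) = false by lia.
    have -> : (y + k == (bsize l).+1) = false by lia.
    by have -> : y + k - (bsize l).+1 = k by lia.
Qed.

(** The vertex labelled as the root of [t] can be rotated to the root of [s],
    because the vertices before it have their right ends before it in [t], hence
    in [s]; then both sides are compared recursively. *)
Lemma tam_le_of_rdesc s t :
  bsize s = bsize t ->
  (forall k, 1 <= k <= bsize s -> rdesc s k <= rdesc t k) -> tam_le s t.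
Proof.
elim: t s => [|tl IHl tr IHr] s /= Hs Hst.
  by case: s Hs Hst => //= *; apply: rt_refl.
have [||a [b [Hle Ha Hra Hrb]]] := tam_rotate_to_root s (bsize tl).+1.
- by lia.
- move=> k Hk; have := Hst k; have := rdesc_bound tl k.
  have -> : k <= bsize tl by lia.
  by lia.
have /= Hsz := bsize_tam_le _ _ Hle.
apply: (rt_trans _ _ _ (Node a b)) => //; apply: tam_le_Node.
  apply: IHl; first by lia.
  move=> k Hk; rewrite Hra; last by lia.
  have := Hst k; have -> : k <= bsize tl by lia.
  by apply; lia.
apply: IHr; first by lia.
move=> k Hk; rewrite Hrb; last by lia.
have := Hst ((bsize tl).+1 + k).
have -> : ((bsize tl).+1 + k <= bsize tl) = false by lia.
have -> : ((bsize tl).+1 + k == (bsize tl).+1) = false by lia.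
have -> : (bsize tl).+1 + k - (bsize tl).+1 = k by lia.
by apply; lia.
Qed.

(** * Graftings and confined blocks of vertices *)

Lemma bsize_graft t i s : bsize (graft t i s) = bsize t + bsize s.
Proof.
elim: t i => [|l IHl r IHr] i //=.
by case: leqP => _ /=; rewrite ?IHl ?IHr; lia.
Qed.

(** A vertex [k] before the grafted leaf [i] gains the inserted tree exactly
    when leaf [i] lies in its right subtree, whose leaves are labelled from
    [k + 1] to [k + rdesc t k + 1]. *)
Lemma rdesc_graft t i s k :
  1 <= i <= (bsize t).+1 -> 1 <= k ->
  rdesc (graft t i s) k =
    if k < i then
      if i <= (k + rdesc t k).+1 then rdesc t k + bsize s else rdesc t k
    else if k < i + bsize s then rdesc s (k - i).+1
    else rdesc t (k - bsize s).
Proof.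
elim: t i k => [|l IHl r IHr] i k /= Hi Hk.
  have -> : i = 1 by lia.
  have -> : (k < 1) = false by lia.
  case: ltnP => Hks; first by have -> : (k - 1).+1 = k by lia.
  by apply: rdesc_default; lia.
case: (leqP i (bsize l).+1) => Hil /=; rewrite ?bsize_graft.
  case: (leqP k (bsize l + bsize s)) => Hkl.
    rewrite IHl; [|lia|lia].
    case: (ltnP k i) => Hki; first by have -> : k <= bsize l by lia.
    case: (ltnP k (i + bsize s)) => Hkis //.
    by have -> : k - bsize s <= bsize l by lia.
  case: (k =P (bsize l + bsize s).+1) => Hke.
    case: (ltnP k i) => Hki.
      have -> : (k <= bsize l) = false by lia.
      have -> : (k == (bsize l).+1) = true by lia.
      by case: ifP; lia.
    have -> : (k < i + bsize s) = false by lia.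
    have -> : (k - bsize s <= bsize l) = false by lia.
    by have -> : (k - bsize s == (bsize l).+1) = true by lia.
  have -> : (k < i) = false by lia.
  have -> : (k < i + bsize s) = false by lia.
  have -> : (k - bsize s <= bsize l) = false by lia.
  have -> : (k - bsize s == (bsize l).+1) = false by lia.
  congr rdesc; lia.
case: (leqP k (bsize l)) => Hkl.
  have -> : k < i by lia.
  by have := rdesc_bound l k Hkl; case: ifP; lia.
case: (k =P (bsize l).+1) => Hke.
  have -> : k < i by lia.
  by have -> : i <= (k + bsize r).+1 by lia.
rewrite IHr; [|lia|lia].
have -> : (k - (bsize l).+1 < i - (bsize l).+1) = (k < i) by lia.
have -> : (k - (bsize l).+1 < i - (bsize l).+1 + bsize s) = (k < i + bsize s).
  by lia.
case: (ltnP k i) => Hki.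
  set d := rdesc r _.
  by have -> : (i - (bsize l).+1 <= (k - (bsize l).+1 + d).+1) =
               (i <= (k + d).+1) by lia.
case: (ltnP k (i + bsize s)) => Hkis; first by congr rdesc; lia.
have -> : (k - bsize s <= bsize l) = false by lia.
have -> : (k - bsize s == (bsize l).+1) = false by lia.
congr rdesc; lia.
Qed.

(** Leaf [i] lies in the left subtree of vertex [i], which therefore receives
    the whole inserted tree; the label of that vertex becomes [i + bsize s]. *)
Lemma ldesc_graft_ge t i s :
  1 <= i <= bsize t -> bsize s <= ldesc (graft t i s) (i + bsize s).
Proof.
elim: t i => [|l IHl r IHr] i /= Hi; first by lia.
case: (leqP i (bsize l).+1) => Hil /=; rewrite ?bsize_graft.
  case: (leqP i (bsize l)) => Hil'.
    have -> : i + bsize s <= bsize l + bsize s by lia.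
    by apply: IHl; lia.
  have -> : (i + bsize s <= bsize l + bsize s) = false by lia.
  have -> : (i + bsize s == (bsize l + bsize s).+1) = true by lia.
  by lia.
have -> : (i + bsize s <= bsize l) = false by lia.
have -> : (i + bsize s == (bsize l).+1) = false by lia.
have -> : i + bsize s - (bsize l).+1 = i - (bsize l).+1 + bsize s by lia.
by apply: IHr; lia.
Qed.

(** The root descends to every vertex, so if it lies in the block then the
    block is the whole tree; otherwise the block lies on one side of it. *)
Lemma graft_of_block u i q :
  1 <= i -> 1 <= q -> i + q <= (bsize u).+1 ->
  (forall k, i <= k < i + q -> k + rdesc u k < i + q /\ i + ldesc u k <= k) ->
  exists u1 u2, u = graft u1 i u2 /\ bsize u2 = q.
Proof.
elim: u i => [|l IHl r IHr] i /= Hi Hq Hiq Hu; first by lia.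
case: (leqP (i + q) (bsize l).+1) => Hl.
  have [||||u1 [u2 [El Hs]]] := IHl i; try lia.
    by move=> k Hk; have := Hu k Hk; have -> : k <= bsize l by lia.
  exists (Node u1 r), u2; split => //=.
  have -> : i <= (bsize u1).+1 by move: Hl; rewrite El bsize_graft; lia.
  by rewrite -El.
case: (leqP i (bsize l).+1) => Hil.
  have := Hu (bsize l).+1; rewrite ltnn eqxx => Hx.
  exists Leaf, (Node l r) => /=.
  by split=> //; lia.
have [||||u1 [u2 [Er Hs]]] := IHr (i - (bsize l).+1); try lia.
  move=> k Hk; have := Hu (k + (bsize l).+1).
  have -> : (k + (bsize l).+1 <= bsize l) = false by lia.
  have -> : (k + (bsize l).+1 == (bsize l).+1) = false by lia.
  by rewrite addnK; lia.
exists (Node l u1), u2; split => //=.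
have -> : (i <= (bsize l).+1) = false by lia.
by rewrite -Er.
Qed.

(** By [rdesc_graft], each right end of a grafting is a strictly increasing
    function of a right end of one of its two parts, and this function depends
    only on the sizes of the parts and on [i]; so it reflects inequalities. *)
Lemma tam_le_graft_inv s1 s2 t1 t2 i :
  bsize s1 = bsize t1 -> bsize s2 = bsize t2 -> 1 <= i <= (bsize s1).+1 ->
  tam_le (graft s1 i s2) (graft t1 i t2) -> tam_le s1 t1 /\ tam_le s2 t2.
Proof.
move=> E1 E2 Hi Hle.
have {Hle}H k : 1 <= k -> rdesc (graft s1 i s2) k <= rdesc (graft t1 i t2) k.
  by move=> _; case: (tam_le_desc _ _ k Hle).
split; apply: tam_le_of_rdesc => // k Hk.
  case: (ltnP k i) => Hki.
    have := H k; rewrite !rdesc_graft ?Hki -?E1 -?E2; try lia.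
    by do 2 case: ifP; lia.
  have := H (k + bsize s2); rewrite !rdesc_graft -?E1 -?E2; try lia.
  have -> : (k + bsize s2 < i) = false by lia.
  have -> : (k + bsize s2 < i + bsize s2) = false by lia.
  by rewrite addnK; apply; lia.
have := H (k + i).-1; rewrite !rdesc_graft -?E1 -?E2; try lia.
have -> : ((k + i).-1 < i) = false by lia.
have -> : ((k + i).-1 < i + bsize s2) = true by lia.
have -> : ((k + i).-1 - i).+1 = k by lia.
by apply; lia.
Qed.

(** Only the left ends of [S] and the right ends of [T] need to stay in the
    block: the left ends of [T] and the right ends of [S] are closer to their
    vertices. *)
Lemma not_new_of_block n S T i q :
  tam_interval n S T ->
  1 <= i -> 1 <= q < n -> i + q <= n.+1 ->
  (forall k, i <= k < i + q -> k + rdesc T k < i + q /\ i + ldesc S k <= k) ->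
  ~ new_interval S T.
Proof.
move=> [HS HT Hle] Hi Hq Hiq Hb; apply.
have [||||S1 [S2 [ES ES2]]] := graft_of_block S i q; try lia.
  by move=> k Hk; have := Hb k Hk; have := tam_le_desc _ _ k Hle; lia.
have [||||T1 [T2 [ET ET2]]] := graft_of_block T i q; try lia.
  by move=> k Hk; have := Hb k Hk; have := tam_le_desc _ _ k Hle; lia.
have HS1 := bsize_graft S1 i S2; have HT1 := bsize_graft T1 i T2.
rewrite -ES in HS1; rewrite -ET in HT1.
have Hle' : tam_le (graft S1 i S2) (graft T1 i T2) by rewrite -ES -ET.
have [|||Hle1 Hle2] := tam_le_graft_inv S1 S2 T1 T2 i _ _ _ Hle'; try lia.
exists (n - q), q, i, S1, T1, S2, T2.
split; [lia | split => //; lia | split => //; lia | lia | by []].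
Qed.

(** * The poset of an interval *)

(** Both inequalities can be required for all [a] and [b], as one of them is
    trivial according to whether [a] is above or below [b]. *)
Lemma poset_of_intervalE n S T a b :
  tam_interval n S T ->
  poset_of_interval n S T a b =
    [&& 1 <= a <= n, 1 <= b <= n, b <= a + ldesc T b & a <= b + rdesc S b].
Proof.
by move=> [HS HT _]; rewrite /poset_of_interval !lhdE HS HT; lia.
Qed.

(** Transitivity at [a], [b], [c] splits into its two inequalities: as left
    intervals shrink and right ones grow from [S] to [T], [b] descends from [c]
    in both trees, so nesting in [T] bounds [a] from below and nesting in [S]
    bounds it from above. *)
Lemma interval_poset_of_interval n S T :
  tam_interval n S T -> interval_poset n (poset_of_interval n S T).
Proof.
move=> H; have E a b := poset_of_intervalE n S T a b H.
have [HS HT Hle] := H; have mon k := tam_le_desc S T k Hle.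
split.
- by move=> a b; rewrite E; lia.
- by move=> a Ha; rewrite E; lia.
- move=> a b; rewrite !E => /and4P[Ha Hb H1 H2] /and4P[_ _ H3 H4].
  have [Ma _] := mon a; have [Mb _] := mon b.
  case: (ltngtP a b) => // Hlt; exfalso.
  + by apply: (desc_antisym T a b); lia.
  + by apply: (desc_antisym T b a); lia.
- move=> a b c; rewrite !E => /and4P[Ha Hb H1 H2] /and4P[_ Hc H3 H4].
  have [Mrc Mlc] := mon c.
  have := desc_nested T c b; have := desc_nested S c b.
  by lia.
- by move=> a b c Hab Hbc; rewrite !E; lia.
- by move=> a b c Hab Hbc; rewrite !E; lia.
Qed.

(** A forbidden pattern encloses the block [1, b - 1], [a + 1, n] or
    [i + 1, j]. The block lies among the descendants in [S] of the vertex
    enclosing it on the left and among those in [T] of the vertex enclosing it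
    on the right, so nesting and antisymmetry confine it. For the converse, the
    last vertex of an inserted block descends in [S] from the vertex before the
    block, and its first vertex descends in [T] from the vertex after it. *)
Theorem theorem4p10 (n : nat) (S T : btree) :
  1 <= n ->
  tam_interval n S T ->
  new_interval S T <-> new_interval_poset n (poset_of_interval n S T).
Proof.
move=> _ H; have E a b := poset_of_intervalE n S T a b H.
have [HS HT Hle] := H.
have left_enclosed a k : 1 <= a <= n -> a < k -> k <= a + rdesc S a ->
    a < k - ldesc S k.
  move=> Ha Hk Hka; have := desc_nested S a k; have := desc_antisym S a k.
  by have := ldesc_bound S k; lia.
have right_enclosed b k : 1 <= k < b -> b <= n -> b <= k + ldesc T b ->
    k + rdesc T k < b.
  move=> Hk Hb Hkb; have := desc_nested T b k; have := desc_antisym T k b.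
  by lia.
split=> [Hnew|].
  split; first exact: interval_poset_of_interval.
  - move=> [b [Hb]]; rewrite E => HP.
    apply: (not_new_of_block n S T 1 b.-1 H) Hnew; try lia.
    move=> k Hk; have := right_enclosed b k; have := ldesc_bound S k; lia.
  - move=> [a [Ha]]; rewrite E => HP.
    apply: (not_new_of_block n S T a.+1 (n - a) H) Hnew; try lia.
    move=> k Hk; have := left_enclosed a k; have := rdesc_bound T k; lia.
  - move=> [i [j [Hij]]]; rewrite !E => HPT HPS.
    apply: (not_new_of_block n S T i.+1 (j - i) H) Hnew; try lia.
    move=> k Hk; have := left_enclosed i k; have := right_enclosed j.+1 k; lia.
move=> [_ Hfirst Hlast Hmid].
move=> [p [q [i [S1 [T1 [S2 [T2 Hgraft]]]]]]].
case: Hgraft => [[Hp Hq] [HS1 HT1 _] [HS2 HT2 _] Hi [ES ET]].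
have Hn : n = p + q by rewrite -HS ES bsize_graft HS1 HS2.
have HL : i <= p -> q <= ldesc T (i + q).
  by move=> Hip; rewrite ET -HT2; apply: ldesc_graft_ge; lia.
have HR : 1 < i -> q <= rdesc S i.-1.
  move=> Hi1; rewrite ES rdesc_graft; try lia.
  have -> : i.-1 < i by lia.
  by case: ifP; lia.
case: (leqP i 1) => Hi1.
  by apply: Hfirst; exists (i + q); rewrite E; lia.
case: (leqP i p) => Hip; last first.
  by apply: Hlast; exists i.-1; rewrite E; lia.
apply: Hmid; exists i.-1, (i + q).-1; rewrite !E.
have -> : i.-1.+1 = i by lia.
have -> : (i + q).-1.+1 = i + q by lia.
by split; lia.
Qed.
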